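(* Suppose $F\in\mathbb{C}^n\otimes\mathbb{C}^n\otimes\mathbb{C}^n$ is a concise tensor of border rank $n$. Then the multigraded ideal $\mathrm{Ann}(F)\subset S$ has at least $n-1$ linearly independent minimal generators in degree $(1,1,1)$.
   Context: $S=\mathbb{C}[\alpha_1,\dots,\alpha_n,\beta_1,\dots,\beta_n,\gamma_1,\dots,\gamma_n]$ is $\mathbb{Z}^3$-graded with $\deg\alpha_i=(1,0,0)$, $\deg\beta_i=(0,1,0)$, $\deg\gamma_i=(0,0,1)$ (the Cox ring of $\mathbb{P}^{n-1}\times\mathbb{P}^{n-1}\times\mathbb{P}^{n-1}$). The variables $\alpha_i$, $\beta_i$, $\gamma_i$ are dual to the standard bases of the three factors, so $\mathbb{C}^n\otimes\mathbb{C}^n\otimes\mathbb{C}^n=(S_{(1,1,1)})^*$. For $\Theta\in S_D$, $\Theta\lrcorner F\in (S_{(1,1,1)-D})^*$ is the functional $\Psi\mapsto F(\Theta\Psi)$; $\mathrm{Ann}(F)=\{\Theta\in S\mid\Theta\lrcorner F=0\}$, a multihomogeneous ideal. $F$ is concise if $\mathrm{Ann}(F)$ is zero in degrees $(1,0,0)$, $(0,1,0)$ and $(0,0,1)$. The border rank of $F$ is the least $r$ such that $F$ is a limit of tensors that are sums of at most $r$ simple tensors $u\otimes v\otimes w$. The number of linearly independent minimal generators of a homogeneous ideal $J$ in degree $D$ is $\dim\big(J_D/(\mathfrak{m}J)_D\big)$, where $\mathfrak m$ is the ideal generated by all variables. *)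

(* Defs.v *)
From mathcomp Require Import all_boot all_order all_algebra.
From mathcomp Require Import complex mpoly.
From mathcomp Require Import boolp classical_sets reals topology normedtype.

Set Implicit Arguments.
Unset Strict Implicit.
Unset Printing Implicit Defensive.

Import Order.TTheory GRing.Theory Num.Theory.
Import numFieldNormedType.Exports.

Local Open Scope classical_set_scope.
Local Open Scope ring_scope.

(* The complex numbers, R being the real numbers.  The type annotation gives
   access to the topology induced by the modulus. *)
Definition C (R : realType) : numClosedFieldType := (complex R : Type).

Section Cox.
Variables (R : realType) (n : nat).

(* The 3n variables are listed as alpha_1..alpha_n, beta_1..beta_n,
   gamma_1..gamma_n. *)
Definition S := {mpoly (C R)[n + n + n]}.

Definition ialpha (i : 'I_n) : 'I_(n + n + n) := lshift n (lshift n i).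
Definition ibeta (i : 'I_n) : 'I_(n + n + n) := lshift n (rshift n i).
Definition igamma (i : 'I_n) : 'I_(n + n + n) := rshift (n + n) i.

Definition degree := (int * int * int)%type.

Definition multideg (m : 'X_{1..n + n + n}) : degree :=
  (\sum_i (m (ialpha i))%:Z,
   \sum_i (m (ibeta i))%:Z,
   \sum_i (m (igamma i))%:Z).

(* The graded piece S_D; it is 0 if D has a negative coordinate. *)
Definition piece (D : degree) : set S :=
  [set P | forall m, m \in msupp P -> multideg m = D].

Definition hcomp (D : degree) (P : S) : S :=
  \sum_(m <- msupp P | multideg m == D) P@_m *: 'X_[m].

(* C^n (x) C^n (x) C^n in coordinates with respect to the standard bases. *)
Definition tensor := {ffun 'I_n * 'I_n * 'I_n -> C R}.

Definition simple_tensor (u v w : 'rV[C R]_n) : tensor :=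
  [ffun t => u 0 t.1.1 * v 0 t.1.2 * w 0 t.2].

Definition rank_at_most (r : nat) (T : tensor) : Prop :=
  exists s, (s <= r)%N /\ exists u v w : 'I_s -> 'rV[C R]_n,
    T = \sum_(l < s) simple_tensor (u l) (v l) (w l).

Definition border_rank_at_most (r : nat) (F : tensor) : Prop :=
  exists T : nat -> tensor, (forall m, rank_at_most r (T m)) /\
    forall t, T m t @[m --> \oo] --> F t.

Definition has_border_rank (F : tensor) (r : nat) : Prop :=
  border_rank_at_most r F /\
  forall r', border_rank_at_most r' F -> (r <= r')%N.

(* F as a functional on S_(1,1,1), where alpha_i beta_j gamma_k is mapped to
   the coordinate (i,j,k) of F; it is extended by 0 to the other degrees. *)
Definition pairing (F : tensor) (P : S) : C R :=
  \sum_t F t *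
    P@_(mnm_add (mnm_add (mnm1 (ialpha t.1.1)) (mnm1 (ibeta t.1.2)))
                (mnm1 (igamma t.2))).

(* For Theta in S_D, the functional Theta _| F has domain S_((1,1,1) - D). *)
Definition contract (F : tensor) (Theta : S) : S -> C R :=
  fun Psi => pairing F (Theta * Psi).

(* As a homogeneous ideal, Ann(F) consists of the polynomials all of whose
   homogeneous components annihilate F. *)
Definition Ann (F : tensor) : set S :=
  [set Theta | forall (D : degree) (Psi : S),
     piece ((1, 1, 1) - D) Psi -> contract F (hcomp D Theta) Psi = 0].

Definition concise (F : tensor) : Prop :=
  forall D : degree, D \in [:: (1, 0, 0); (0, 1, 0); (0, 0, 1)] ->
    Ann F `&` piece D = [set 0].

Definition ideal_gen (G : set S) : set S :=
  [set P | exists k (a g : 'I_k -> S),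
     (forall i, G (g i)) /\ P = \sum_i a i * g i].

Definition ideal_mul (I J : set S) : set S :=
  [set P | exists k (a b : 'I_k -> S),
     (forall i, I (a i) /\ J (b i)) /\ P = \sum_i a i * b i].

Definition max_ideal : set S := ideal_gen [set P | exists i, P = 'X_i].

(* dim (V / W) = d, for subspaces W of V: some v_1..v_d in V induce a basis
   of V / W. *)
Definition dim_quotient (V W : set S) (d : nat) : Prop :=
  exists v : 'I_d -> S,
    [/\ forall i, V (v i),
        forall c : 'I_d -> C R,
          W (\sum_i c i *: v i) -> forall i, c i = 0
      & forall x, V x -> exists c : 'I_d -> C R,
          W (x - \sum_i c i *: v i)].

Definition num_min_generators (J : set S) (D : degree) (d : nat) : Prop :=
  dim_quotient (J `&` piece D) (ideal_mul max_ideal J `&` piece D) d.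

End Cox.

(* Main.v *)
Require Import Defs.
From HB Require Import structures.
From mathcomp Require Import all_boot all_order all_algebra.
From mathcomp Require Import complex mpoly.
From mathcomp Require Import zify.
From mathcomp Require Import boolp classical_sets reals topology normedtype.

Set Implicit Arguments.
Unset Strict Implicit.
Unset Printing Implicit Defensive.

Import Order.TTheory GRing.Theory Num.Theory.
Import numFieldNormedType.Exports.

Local Open Scope classical_set_scope.
Local Open Scope ring_scope.

(** Why the theorem holds.  For matrices X, Y, Z acting on the three factors
    of the space of tensors, write X.F, Y.F, Z.F for the results of applying
    them to F in one slot only, and consider the space K of triples with
    X.F = Y.F = Z.F.

    Each such triple yields a tensor G = X.F = Y.F = Z.F that kills the
    degree (1,1,1) part of m Ann(F) ([max_ideal_Ann_perp]).  A product of a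
    variable and an element of Ann(F) involves a variable of one of the three
    slots, say alpha_i; pairing alpha_i Q with X.F is the same as pairing a
    linear combination of the alpha_j Q with F ([pairing_act]), and F pairs to
    0 with the whole ideal Ann(F) ([Ann_pairing]).  Conciseness says that X.F
    determines X, and likewise for Y and Z ([concise_act_inj]), so G
    determines the triple and the space of tensors G has dimension dim K.

    The dimension of K is at least n.  The space K is the kernel of a linear
    map whose matrix depends linearly on F, so that dim K can only jump up in a
    limit ([rank_limit_le], [cvg_lin_mx_act_diff]); hence it is enough to
    bound it for a sum of at most n products u_l (x) v_l (x) w_l
    ([rank_ker_act_diff]).
    If the u_l, the v_l and the w_l are bases, the triples of matrices that are
    diagonal in these bases, with the same eigenvalues, form an n-dimensional
    subspace of K.  If for instance the u_l do not span, some nonzero covector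
    vanishes on all of them, and the rank one matrices built from this covector
    kill the tensor in the first slot; paired with Y = Z = 0 they form an
    n-dimensional subspace of K.

    In degree (1,1,1), with N = n^3 monomials, Ann(F) is the space of the
    forms that F kills, of dimension at least N - 1, while the part of
    m Ann(F) lies in the common kernel of at least n independent tensors, so
    has dimension at most N - n.  The difference is at least n - 1. *)

(** * Ranks of limits, and quotients of row spaces *)

Lemma cvg_det (K : numFieldType) r (A : nat -> 'M[K]_r) (B : 'M[K]_r) :
  (forall i j, A m i j @[m --> \oo] --> B i j) ->
  \det (A m) @[m --> \oo] --> \det B.
Proof.
move=> AB; rewrite /determinant.
apply: cvg_big => [|s _]; first exact: add_continuous.
apply: cvgM; first exact: cvg_cst.
apply: cvg_big => [|i _]; first exact: mul_continuous.
exact: AB.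
Qed.

Lemma cvg_mulmx (K : numFieldType) p q r 
    (A : nat -> 'M[K]_(p, q)) (A' : 'M[K]_(p, q))
    (B : nat -> 'M[K]_(q, r)) (B' : 'M[K]_(q, r)) :
  (forall i j, A m i j @[m --> \oo] --> A' i j) ->
  (forall i j, B m i j @[m --> \oo] --> B' i j) ->
  forall i j, (A m *m B m) i j @[m --> \oo] --> (A' *m B') i j.
Proof.
move=> AA' BB' i j; rewrite mxE; under eq_fun do rewrite mxE.
apply: cvg_big => [|k _]; first exact: add_continuous.
exact: cvgM.
Qed.

(** Pick P and Q with P B Q the identity of size [\rank B].  The determinant of
    P A_m Q tends to 1, so is nonzero for large m, which forces A_m to have
    rank at least that of B. *)
Lemma rank_limit_le (K : numFieldType) p q (A : nat -> 'M[K]_(p, q))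
    (B : 'M[K]_(p, q)) r :
  (forall i j, A m i j @[m --> \oo] --> B i j) ->
  (forall m, (\rank (A m) <= r)%N) -> (\rank B <= r)%N.
Proof.
move=> AB rA; rewrite leqNgt; apply/negP => rB.
have [P PB] : exists P, P *m col_base B = 1%:M by exact/row_fullP/col_base_full.
have [Q BQ] : exists Q, row_base B *m Q = 1%:M by exact/row_freeP/row_base_free.
have PBQ : P *m B *m Q = 1%:M.
  transitivity (P *m (col_base B *m row_base B) *m Q).
    by rewrite mulmx_base.
  by rewrite mulmxA PB mul1mx BQ.
have cvg_const p' q' (D : 'M[K]_(p', q')) i j :
    D i j @[_ --> (\oo : set_system nat)] --> D i j.
  exact: cvg_cst.
have lim1 : \det (P *m A m *m Q) @[m --> \oo] --> (1 : K).
  rewrite -(@det1 K (\rank B)) -PBQ.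
  by apply/cvg_det/cvg_mulmx => //; exact: cvg_mulmx.
have lim0 : \det (P *m A m *m Q) @[m --> \oo] --> (0 : K).
  rewrite (_ : (fun m => _) = fun=> 0); first exact: cvg_cst.
  apply/funext => m /=; apply/eqP; apply: contraTT rB => nz.
  rewrite -leqNgt; apply: leq_trans (rA m).
  have /mxrank_unit <- : P *m A m *m Q \in unitmx by rewrite unitmxE unitfE.
  by rewrite (leq_trans (mxrankM_maxl _ _)) ?mxrankM_maxr.
pose dets : set_system K := \det (P *m A m *m Q) @[m --> \oo].
have /eqP : (1 : K) = 0 by exact: (@norm_cvg_unique K K dets _ 1 0 lim1 lim0).
by rewrite oner_eq0.
Qed.

(** A matrix of largest rank among those whose row space lies in W works: a
    vector of W outside of its row space could be added to it. *)
Lemma subspace_row_space (K : fieldType) N (W : set 'rV[K]_N) :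
  W 0 -> (forall c x y, W x -> W y -> W (c *: x + y)) ->
  exists B : 'M[K]_N, forall x, W x <-> (x <= B)%MS.
Proof.
move=> W0 WD.
pose good r :=
  `[< exists B : 'M[K]_N, (forall x, (x <= B)%MS -> W x) /\ \rank B = r >].
have good0 : exists r, good r.
  exists 0; apply/asboolP; exists 0; split; last exact: mxrank0.
  by move=> x; rewrite submx0 => /eqP->.
have goodN r : good r -> (r <= N)%N.
  by move=> /asboolP[B [_ <-]]; exact: rank_leq_row.
have [r /asboolP[B [BW rB]] rmax] := ex_maxnP good0 goodN.
exists B => x; split=> [Wx|]; last exact: BW.
have Bx : (B <= B + x)%MS by exact: addsmxSl.
suff : (B == B + x)%MS.
  by move=> /andP[_]; exact/submx_trans/addsmxSr.
rewrite -(mxrank_leqif_eq Bx) eqn_leq mxrankS //= rB.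
apply: rmax; apply/asboolP; exists (B + x)%MS; split=> // y.
move=> /sub_addsmxP[[u v] /= ->].
have -> : v *m x = v 0 0 *: x by rewrite [v]mx11_scalar mul_scalar_mx mxE.
by rewrite addrC; apply: WD => //; apply: BW; exact: submxMl.
Qed.

(** Coordinates reduce the dimension of V / W to ranks: the images under phi of
    a basis of a complement of B in A are a basis of V / W. *)
Lemma dim_quotient_row_spaces (R : realType) (n N : nat)
    (phi : {linear 'rV[C R]_N -> S R n}) (V W : set (S R n))
    (A B : 'M[C R]_N) :
    (forall P, V P <-> exists2 r, (r <= A)%MS & P = phi r) ->
    (forall r, W (phi r) <-> (r <= B)%MS) -> (B <= A)%MS ->
  dim_quotient V W (\rank A - \rank B).
Proof.
move=> VA WB BA.
have <- : \rank (A :\: B)%MS = (\rank A - \rank B)%N.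
  by rewrite -(mxrank_cap_compl A B) (capmx_idPr BA) addKn.
pose E := row_base (A :\: B)%MS.
have comb (c : 'I_(\rank (A :\: B)%MS) -> C R) :
    \sum_i c i *: phi (row i E) = phi ((\row_i c i) *m E).
  rewrite mulmx_sum_row linear_sum; apply: eq_bigr => i _ /=.
  by rewrite linearZ mxE.
have EA u : (u *m E <= A :\: B)%MS.
  by rewrite (submx_trans (submxMl _ _)) // eq_row_base.
exists (fun i => phi (row i E)); split.
- move=> i; apply/VA; exists (row i E) => //.
  by rewrite rowE (submx_trans (EA _ _)) ?diffmxSl.
- move=> c; rewrite comb => /WB cB i.
  have : (\row_i c i *m E <= (A :\: B) :&: B)%MS by rewrite sub_capmx EA.
  rewrite capmx_diff submx0 => /eqP cE0.
  have /rowP/(_ i) : \row_i c i = 0.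
    by apply: (row_free_inj (row_base_free (A :\: B)%MS)); rewrite mul0mx.
  by rewrite !mxE.
move=> _ /VA[r rA ->].
have : (r <= (A :\: B) + B)%MS.
  rewrite (submx_trans rA) // -{1}(addsmx_diff_cap_eq A B).
  by rewrite addsmxS ?capmxSr.
case/sub_addsmxP => -[u v] /= ->.
have [w ->] : exists w, u *m (A :\: B)%MS = w *m E.
  by apply/submxP; rewrite (submx_trans (submxMl _ _)) // eq_row_base.
exists (fun i => w 0 i); rewrite comb -linearB /=.
apply/WB; rewrite (_ : \row_i w 0 i = w); last by apply/rowP => i; rewrite mxE.
by rewrite addrC addKr submxMl.
Qed.

(** * Monomials indexed by slots *)

(** The three factors are numbered by ['I_3], so that one statement covers the
    alpha, beta and gamma variables. *)
Definition slotA : 'I_3 := @Ordinal 3 0 isT.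
Definition slotB : 'I_3 := @Ordinal 3 1 isT.
Definition slotC : 'I_3 := @Ordinal 3 2 isT.

Lemma slot_ind (P : 'I_3 -> Prop) :
  P slotA -> P slotB -> P slotC -> forall s, P s.
Proof.
move=> A B C [m lt]; case: m lt => [|[|[|//]]] lt.
- by rewrite (_ : Ordinal lt = slotA) //; apply: val_inj.
- by rewrite (_ : Ordinal lt = slotB) //; apply: val_inj.
- by rewrite (_ : Ordinal lt = slotC) //; apply: val_inj.
Qed.

Section Slots.
Variable n : nat.
Implicit Types (s : 'I_3) (t : 'I_n * 'I_n * 'I_n) (i j : 'I_n).
Implicit Types (m : 'X_{1..n + n + n}) (D : degree).

Definition entry s t : 'I_n :=
  match val s with 0 => t.1.1 | 1 => t.1.2 | _ => t.2 end.

Definition set_entry s t i : 'I_n * 'I_n * 'I_n :=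
  match val s with
  | 0 => (i, t.1.2, t.2) | 1 => (t.1.1, i, t.2) | _ => (t.1.1, t.1.2, i)
  end.

Definition var s i : 'I_(n + n + n) :=
  match val s with 0 => ialpha i | 1 => ibeta i | _ => igamma i end.

Definition slot_degree s D : int :=
  match val s with 0 => D.1.1 | 1 => D.1.2 | _ => D.2 end.

Definition slot_unit s : degree :=
  match val s with 0 => (1, 0, 0) | 1 => (0, 1, 0) | _ => (0, 0, 1) end.

(** The monomial alpha_i beta_j gamma_k for t = (i,j,k), in the very form in
    which it occurs in [pairing]. *)
Definition tmon t : 'X_{1..n + n + n} :=
  mnm_add (mnm_add (mnm1 (ialpha t.1.1)) (mnm1 (ibeta t.1.2)))
          (mnm1 (igamma t.2)).

Lemma entry_set_entry s s' t i :
  entry s' (set_entry s t i) = if s' == s then i else entry s' t.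
Proof. by elim/slot_ind: s; elim/slot_ind: s'. Qed.

Lemma entryP t t' : (forall s, entry s t = entry s t') -> t = t'.
Proof.
case: t t' => [[i j] k] [[i' j'] k'] e.
have := e slotC; have := e slotB; have := e slotA.
by rewrite /entry /= => -> -> ->.
Qed.

Lemma set_entryK s t : set_entry s t (entry s t) = t.
Proof.
by apply: entryP => s'; rewrite entry_set_entry; case: eqP => // ->.
Qed.

Lemma set_set_entry s t i j : set_entry s (set_entry s t i) j = set_entry s t j.
Proof.
by apply: entryP => s'; rewrite !entry_set_entry; case: eqP.
Qed.

Lemma var_eq s s' i j : (var s i == var s' j) = (s == s') && (i == j).
Proof.
by elim/slot_ind: s; elim/slot_ind: s';
  rewrite /var /ialpha /ibeta /igamma /=
    ?eq_lshift ?eq_rshift ?eq_lrshift ?eq_rlshift //.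
Qed.

Lemma varP (x : 'I_(n + n + n)) : exists s i, x = var s i.
Proof.
rewrite -[x]splitK; case: (split x) => [y|k] /=; last first.
  by exists slotC, k.
rewrite -[y]splitK; case: (split y) => [i|j] /=.
  by exists slotA, i.
by exists slotB, j.
Qed.

Lemma slot_degreeP D D' :
  (forall s, slot_degree s D = slot_degree s D') -> D = D'.
Proof.
case: D D' => [[a b] c] [[a' b'] c'] e.
have := e slotC; have := e slotB; have := e slotA.
by rewrite /slot_degree /= => -> -> ->.
Qed.

Lemma slot_degree_multideg s m :
  slot_degree s (multideg m) = \sum_i (m (var s i))%:Z.
Proof. by elim/slot_ind: s. Qed.

Lemma multidegD m m' : multideg (m + m')%MM = multideg m + multideg m'.
Proof.
apply: slot_degreeP => s.
transitivity (slot_degree s (multideg m) + slot_degree s (multideg m')).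
  rewrite !slot_degree_multideg -big_split /=.
  by apply: eq_bigr => i _; rewrite mnmDE PoszD.
by elim/slot_ind: s.
Qed.

Lemma multideg_eq0 m : multideg m = 0 -> m = 0%MM.
Proof.
move=> m0; apply/mnmP => x; have [s [i ->]] := varP x.
have : slot_degree s (multideg m) = 0 by rewrite m0; elim/slot_ind: s.
rewrite slot_degree_multideg mnm0E => /eqP.
rewrite psumr_eq0 => [/allP/(_ i (mem_index_enum i))|//].
by move/eqP => [].
Qed.

Lemma tmon_var t s i : tmon t (var s i) = (entry s t == i).
Proof.
rewrite /tmon !mnmDE !mnm1E.
have := var_eq slotA s t.1.1 i; have := var_eq slotB s t.1.2 i.
have := var_eq slotC s t.2 i; rewrite /var /= => -> -> ->.
by elim/slot_ind: s => /=; rewrite ?addn0 ?add0n.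
Qed.

Lemma tmon_inj : injective tmon.
Proof.
move=> t t' e; apply: entryP => s; apply/esym/eqP.
by have := tmon_var t' s (entry s t); rewrite -e tmon_var eqxx; case: eqP.
Qed.

Lemma tmonP m : multideg m = (1, 1, 1) <-> exists t, m = tmon t.
Proof.
split=> [m1|[t ->]]; last first.
  apply: slot_degreeP => s; rewrite slot_degree_multideg.
  rewrite (bigD1 (entry s t)) //=.
  rewrite tmon_var eqxx big1 ?addr0; first by elim/slot_ind: s.
  by move=> i /negPf ne; rewrite tmon_var eq_sym ne.
have ex s : exists i, [forall j, m (var s j) == (i == j)].
  have : slot_degree s (multideg m) = 1 by rewrite m1; elim/slot_ind: s.
  rewrite slot_degree_multideg -(big_morph Posz PoszD (erefl _)) => -[] /eqP.
  move=> /sum_nat_eq1[i [_ mi m0]]; exists i; apply/forallP => j; apply/eqP.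
  by have [<-|ne] := eqVneq i j; rewrite ?mi // m0 // eq_sym.
pose f s := xchoose (ex s).
exists (f slotA, f slotB, f slotC); apply/mnmP => x.
have [s [i ->]] := varP x; rewrite tmon_var (eqP (forallP (xchooseP (ex s)) i)).
congr (nat_of_bool (_ == _)).
by elim/slot_ind: s.
Qed.
End Slots.

(** * The contraction of a tensor and its annihilator *)

Lemma mcoeffMX_sub (K : nzRingType) k (Q : {mpoly K[k]}) (e m : 'X_{1..k}) :
  (Q * 'X_[e])@_m = if (e <= m)%MM then Q@_(m - e) else 0.
Proof.
case: ifP => [le|nle]; first by rewrite -{1}(submK le) addmC mcoeffMX.
apply/eqP; rewrite mcoeff_eq0 (perm_mem (msuppMX _ _)).
apply/negP => /mapP[m' _ def_m]; move/negP: nle; apply.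
by apply/mnm_lepP => i; rewrite def_m mnmDE leq_addr.
Qed.

Section Apolarity.
Variables (R : realType) (n : nat).
Implicit Types (F G : tensor R n) (P Q Psi : S R n) (X : 'M[C R]_n).

Lemma mcoeff_hcomp D P m :
  (hcomp D P)@_m = if multideg m == D then P@_m else 0.
Proof.
rewrite /hcomp raddf_sum /=.
have [Pm|Pm] := boolP (m \in msupp P); last first.
  rewrite big1_seq ?(mcoeff_eq0 P m _) ?(memN_msupp_eq0 Pm) ?if_same //.
  move=> m' /andP[_ m'P]; rewrite mcoeffZ mcoeffX.
  by case: eqP Pm => [<-|_ _]; rewrite ?m'P ?mulr0.
rewrite big_mkcond (bigD1_seq m) ?msupp_uniq //= big1 ?addr0.
  by case: eqP => // _; rewrite mcoeffZ mcoeffX eqxx mulr1.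
move=> m' /negPf ne; case: ifP => // _.
by rewrite mcoeffZ mcoeffX ne mulr0.
Qed.

Lemma hcomp_piece D D' P : piece D' P -> hcomp D P = if D == D' then P else 0.
Proof.
move=> PD; apply/mpolyP => m; rewrite mcoeff_hcomp.
have [mP|/memN_msupp_eq0 m0] := boolP (m \in msupp P).
  by rewrite (PD m mP) eq_sym; case: eqP; rewrite ?mcoeff0.
by rewrite m0 if_same; case: eqP => _; rewrite ?mcoeff0 ?m0.
Qed.

Lemma piece_mcoeff D P m : piece D P -> multideg m != D -> P@_m = 0.
Proof.
move=> PD ne; apply: memN_msupp_eq0; apply: contra ne => /PD ->; exact: eqxx.
Qed.

Fact pairing_is_linear F : GRing.linear_for *%R (pairing F).
Proof.
move=> c P Q; rewrite /pairing mulr_sumr -big_split /=; apply: eq_bigr => t _.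
by rewrite mcoeffD mcoeffZ mulrDr mulrCA.
Qed.
HB.instance Definition _ F :=
  GRing.isLinear.Build (C R) (S R n) (C R) *%R (pairing F)
    (pairing_is_linear F).

Definition act (s : 'I_3) X F : tensor R n :=
  [ffun t => \sum_i X (entry s t) i * F (set_entry s t i)].

Lemma pairing_varM F s i Q :
  pairing F ('X_(var s i) * Q) =
  \sum_(t | entry s t == i) F t * Q@_(tmon t - U_(var s i)).
Proof.
rewrite /pairing [RHS]big_mkcond; apply: eq_bigr => t _.
rewrite -/(tmon t) -commr_mpolyX mcoeffMX_sub.
have -> : (U_(var s i) <= tmon t)%MM = (entry s t == i).
  apply/mnm_lepP/eqP => [/(_ (var s i))|<- x].
    by rewrite mnm1E eqxx tmon_var; case: eqP.
  by rewrite mnm1E; case: eqP => // <-; rewrite tmon_var eqxx.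
by case: eqP => _; rewrite ?mulr0.
Qed.

(** The product of the two variables of the monomial outside of slot s does not
    see the entry in slot s. *)
Lemma tmon_set_entry s (t : 'I_n * 'I_n * 'I_n) i :
  (tmon (set_entry s t i) - U_(var s i) = tmon t - U_(var s (entry s t)))%MM.
Proof.
apply/mnmP => x; have [s' [j ->]] := varP x.
rewrite !mnmBE !mnm1E !tmon_var entry_set_entry !var_eq [s == s']eq_sym.
by have [->|_] := eqVneq s' s; rewrite ?subnn.
Qed.

(** Moving a matrix from the tensor to the variables.  The cofactor Q is
    arbitrary: alpha_i Q pairs with a tensor through the entries of its i-th
    slice only, and the i-th slice of X.F is the combination of the slices of F
    with coefficients X i j. *)
Lemma pairing_act s X F i Q :
  pairing (act s X F) ('X_(var s i) * Q) =
  \sum_j X i j * pairing F ('X_(var s j) * Q).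
Proof.
rewrite pairing_varM.
under eq_bigr => t /eqP ti.
  rewrite ffunE ti mulr_suml.
  under eq_bigr => j _ do rewrite -mulrA -{2}ti -(tmon_set_entry s t j).
  over.
rewrite exchange_big /=; apply: eq_bigr => j _.
rewrite pairing_varM mulr_sumr.
rewrite (reindex_onto (fun t => set_entry s t i) (fun t => set_entry s t j)) /=.
  apply: eq_big => [t|t /andP[_ /eqP ->]//].
  rewrite entry_set_entry eqxx /= eqxx set_set_entry /=.
  by apply/eqP/eqP => [<-|<-]; rewrite ?set_entryK // entry_set_entry eqxx.
by move=> t /eqP <-; rewrite set_set_entry set_entryK.
Qed.

(** [Ann F] is defined through homogeneous components; this is the property that
    makes it behave as an ideal.  For a monomial Psi of degree E, only the
    component of P of degree (1,1,1) - E contributes to the pairing of P Psi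
    with F. *)
Lemma Ann_pairing F P Psi : Ann F P -> pairing F (P * Psi) = 0.
Proof.
move=> PF; rewrite [Psi]mpolyE mulr_sumr linear_sum /= big1 // => m _.
rewrite -scalerAr linearZ /=.
suff -> : pairing F (P * 'X_[m]) =
          contract F (hcomp ((1, 1, 1) - multideg m) P) 'X_[m].
  rewrite PF ?mulr0 // => m'; rewrite msuppX inE => /eqP ->.
  by rewrite opprB addrC subrK.
apply: eq_bigr => t _; congr (_ * _); rewrite -/(tmon t) !mcoeffMX_sub.
case: ifP => // le; rewrite mcoeff_hcomp.
suff -> : multideg (tmon t - m)%MM = (1, 1, 1) - multideg m by rewrite eqxx.
apply/eqP; rewrite eq_sym subr_eq -multidegD submK //.
by apply/eqP/esym/tmonP; exists t.
Qed.

Lemma pairing_Ann F D P :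
  piece D P -> (forall Psi, pairing F (P * Psi) = 0) -> Ann F P.
Proof.
move=> PD PF D' Psi _; rewrite /contract (hcomp_piece _ PD).
by case: eqP => // _; rewrite mul0r linear0.
Qed.

(** If X.F = 0, each row of X gives a linear form in the variables of slot s
    that annihilates F, by [pairing_act] with the left-hand side zero. *)
Lemma concise_act_inj F s X : concise F -> act s X F = 0 -> X = 0.
Proof.
move=> cF XF; apply/matrixP => i j; rewrite [RHS]mxE.
pose P : S R n := \sum_j X i j *: 'X_(var s j).
have Pcoef m : P@_m = \sum_j X i j * (U_(var s j) == m)%MM%:R.
  by rewrite raddf_sum; apply: eq_bigr => k _; rewrite /= mcoeffZ mcoeffX.
have PD : piece (slot_unit s) P.
  move=> m; rewrite mcoeff_msupp Pcoef => nz.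
  have [k /eqP <-] : exists k, (U_(var s k) == m)%MM.
    apply/existsP; apply: contraNT nz => /existsPn nx.
    by rewrite big1 // => k _; rewrite (negPf (nx k)) mulr0.
  apply: slot_degreeP => s'; rewrite slot_degree_multideg.
  under eq_bigr do rewrite mnm1E var_eq.
  have [->|ne] := eqVneq s s'.
    rewrite (bigD1 k) //= eqxx big1 ?addr0; first by elim/slot_ind: s'.
    by move=> k' /negPf; rewrite eq_sym => ->.
  rewrite big1 //.
  by move: ne; elim/slot_ind: s' => /negPf; elim/slot_ind: s {XF P Pcoef nz}.
have : (Ann F `&` piece (slot_unit s)) P.
  split=> //; apply: (pairing_Ann PD) => Psi.
  rewrite mulr_suml linear_sum /=.
  under eq_bigr do rewrite -scalerAl linearZ /=.
  rewrite -(pairing_act s X F i) XF /pairing big1 // => t _.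
  by rewrite ffunE mul0r.
rewrite cF; last by elim/slot_ind: s {XF P Pcoef PD}.
move=> P0; have := Pcoef U_(var s j)%MM; rewrite P0 mcoeff0 (bigD1 j) //=.
rewrite eqxx mulr1 big1 ?addr0 // => k ne.
case: eqP => [/mnmP/(_ (var s k))|]; rewrite ?mulr0 // !mnm1E eqxx !var_eq.
by rewrite eqxx eq_sym (negPf ne).
Qed.

End Apolarity.

(** * Forms in the product of the maximal ideal and the annihilator *)

Section Ideals.
Variables (R : realType) (n : nat).
Implicit Types (I J : set (S R n)).

Lemma ideal_gen_mull I c P : ideal_gen I P -> ideal_gen I (c * P).
Proof.
move=> [k [a [g [Ig ->]]]]; exists k, (fun i => c * a i), g; split=> //.
by rewrite mulr_sumr; apply: eq_bigr => i _; exact: mulrA.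
Qed.

Lemma ideal_mul0 I J : ideal_mul I J 0.
Proof.
exists 0, (fun=> 0), (fun=> 0); split; last by rewrite big_ord0.
by case.
Qed.

Lemma ideal_mulD I J P Q :
  ideal_mul I J P -> ideal_mul I J Q -> ideal_mul I J (P + Q).
Proof.
move=> [k [a [b [ab ->]]]] [k' [a' [b' [ab' ->]]]].
pose cat T (f : 'I_k -> T) f' (i : 'I_(k + k')) :=
  match split i with inl j => f j | inr j => f' j end.
exists (k + k')%N, (cat _ a a'), (cat _ b b'); split.
  by move=> i; rewrite /cat; case: split.
rewrite big_split_ord /cat /=; congr (_ + _); apply: eq_bigr => i _.
  by rewrite (unsplitK (inl i)).
by rewrite (unsplitK (inr i)).
Qed.

Lemma max_ideal_mulZ J c P :
  ideal_mul (@max_ideal R n) J P -> ideal_mul (@max_ideal R n) J (c *: P).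
Proof.
move=> [k [a [b [ab ->]]]]; exists k, (fun i => c%:MP * a i), b; split.
  by move=> i; have [aI bJ] := ab i; split=> //; exact: ideal_gen_mull.
rewrite scaler_sumr; apply: eq_bigr => i _ /=.
by rewrite mul_mpolyC scalerAl.
Qed.

(** A multiple of a variable of slot s is handled by the presentation of G as
    [act s (X s) F]; this is why G has to be of this form for all three
    slots. *)
Lemma max_ideal_Ann_perp (F G : tensor R n) (X : 'I_3 -> 'M[C R]_n) P :
  (forall s, act s (X s) F = G) ->
  ideal_mul (@max_ideal R n) (Ann F) P -> pairing G P = 0.
Proof.
move=> XG [k [a [b [ab ->]]]]; rewrite linear_sum big1 // => i _ /=.
have [[l [c [g [gX ->]]]] bF] := ab i.
rewrite mulr_suml linear_sum big1 // => j _ /=.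
have [x ->] := gX j; have [s [m ->]] := varP x.
rewrite mulrAC mulrC -(XG s) pairing_act big1 // => m' _.
by rewrite [Y in pairing F Y]mulrA [Y in pairing F Y]mulrC Ann_pairing ?mulr0.
Qed.

End Ideals.

(** * Triples of matrices with the same effect on a tensor *)

Section Abundance.
Variables (R : realType) (n : nat).
Notation triples := ('I_n * 'I_n * 'I_n)%type.
Notation N := #|{: triples}|.
Implicit Types (F T : tensor R n) (x : 'M[C R]_(3, n * n)).

Definition slot_mx x (s : 'I_3) : 'M[C R]_n := vec_mx (row s x).

(** The triple of matrices is stored as the three rows of x, each a flattened
    square matrix.  The kernel of this map is the space of triples that have
    the same effect on F in each slot; the row of slotA is zero. *)
Definition act_diff F x : 'M[C R]_(3, N) :=
  \matrix_(s, k) (act s (slot_mx x s) F (enum_val k)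
                  - act slotA (slot_mx x slotA) F (enum_val k)).

Lemma act_linear s F c (X Y : 'M[C R]_n) t :
  act s (c *: X + Y) F t = c * act s X F t + act s Y F t.
Proof.
rewrite !ffunE mulr_sumr -big_split; apply: eq_bigr => i _ /=.
by rewrite !mxE mulrDl mulrA.
Qed.

Lemma act0 s F : act s 0 F = 0.
Proof.
by apply/ffunP => t; rewrite !ffunE big1 // => i _; rewrite mxE mul0r.
Qed.

Lemma act1 s F : act s 1%:M F = F.
Proof.
apply/ffunP => t; rewrite ffunE (bigD1 (entry s t)) //= big1 ?addr0.
  by rewrite mxE eqxx mul1r set_entryK.
by move=> i /negPf ne; rewrite mxE eq_sym ne mul0r.
Qed.

Lemma slot_mx_linear c x y s :
  slot_mx (c *: x + y) s = c *: slot_mx x s + slot_mx y s.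
Proof. by rewrite /slot_mx !linearP. Qed.

Fact act_diff_is_linear F : linear (act_diff F).
Proof.
move=> c x y; apply/matrixP => s k.
rewrite !mxE !slot_mx_linear !act_linear mulrBr !opprD !addrA.
by congr (_ - _); rewrite addrAC.
Qed.
HB.instance Definition _ F :=
  GRing.isLinear.Build _ _ _ _ (act_diff F) (act_diff_is_linear F).

Lemma act_diff_eq0 F x :
  act_diff F x = 0 <->
  forall s, act s (slot_mx x s) F = act slotA (slot_mx x slotA) F.
Proof.
split=> [/matrixP x0 s|xF]; last first.
  by apply/matrixP => s k; rewrite !mxE xF subrr.
apply/ffunP => t; apply/eqP; rewrite -subr_eq0; apply/eqP.
by have := x0 s (enum_rank t); rewrite !mxE enum_rankK.
Qed.

Lemma cvg_act (T : nat -> tensor R n) F s X t :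
  (forall t', T m t' @[m --> \oo] --> F t') ->
  act s X (T m) t @[m --> \oo] --> act s X F t.
Proof.
move=> TF; rewrite ffunE; under eq_fun do rewrite ffunE.
apply: cvg_big => [|i _]; first exact: add_continuous.
by apply: cvgM; [exact: cvg_cst | exact: TF].
Qed.

Lemma cvg_lin_mx_act_diff (T : nat -> tensor R n) F :
  (forall t, T m t @[m --> \oo] --> F t) ->
  forall i j, lin_mx (act_diff (T m)) i j @[m --> \oo] -->
              lin_mx (act_diff F) i j.
Proof.
move=> TF i j; case/mxvec_indexP: j => s k.
have entryE G : lin_mx (act_diff G) i (mxvec_index s k) =
    act s (slot_mx (vec_mx (delta_mx 0 i)) s) G (enum_val k)
    - act slotA (slot_mx (vec_mx (delta_mx 0 i)) slotA) G (enum_val k).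
  by rewrite mxE /= mxvecE mxE.
rewrite entryE (funext (fun m => entryE (T m))).
by apply: cvgB; exact: cvg_act.
Qed.

(** A lower bound for the kernel by an injective linear parametrization, given
    slot by slot. *)
Lemma rank_ker_act_diff_param r F (X : 'I_3 -> 'rV[C R]_r -> 'M[C R]_n) :
    (forall s, linear (X s)) ->
    (forall c s, act s (X s c) F = act slotA (X slotA c) F) ->
    (forall c, (forall s, X s c = 0) -> c = 0) ->
  (r <= \rank (kermx (lin_mx (act_diff F))))%N.
Proof.
move=> Xlin XF Xinj.
pose f (c : 'rV[C R]_r) := mxvec (\matrix_s mxvec (X s c)).
have flin : linear f.
  move=> a c d; rewrite /f -linearP; congr mxvec; apply/row_matrixP => s.
  by rewrite linearP /= !rowK Xlin linearP.
have slotf c s : slot_mx (vec_mx (f c)) s = X s c.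
  by rewrite /slot_mx mxvecK rowK mxvecK.
pose fL : {linear _ -> _} := HB.pack f (GRing.isLinear.Build _ _ _ _ f flin).
have free : row_free (lin1_mx fL).
  apply: inj_row_free => c; rewrite mul_rV_lin1 /= => fc0.
  by apply: Xinj => s; rewrite -slotf fc0 /slot_mx !linear0.
rewrite -(eqP free) mxrankS //; apply/sub_kermxP/row_matrixP => i.
rewrite row_mul rowE (mul_rV_lin1 fL) mul_rV_lin /= row0.
apply/eqP; rewrite mxvec_eq0; apply/eqP/act_diff_eq0 => s.
by rewrite !slotf.
Qed.

Lemma act_sum_products r (U : 'I_3 -> 'M[C R]_(r, n)) F s X t :
    (forall t, F t = \sum_l \prod_s' U s' l (entry s' t)) ->
  act s X F t =
  \sum_l (U s *m X^T) l (entry s t) * \prod_(s' | s' != s) U s' l (entry s' t).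
Proof.
move=> FU; rewrite ffunE.
under eq_bigr => i _ do rewrite FU mulr_sumr.
rewrite exchange_big; apply: eq_bigr => l _ /=.
rewrite mxE mulr_suml; apply: eq_bigr => i _.
rewrite (bigD1 s) //= entry_set_entry eqxx mxE mulrA [_ * U s l i]mulrC.
congr (_ * _); apply: eq_bigr => s' /negPf ne.
by rewrite entry_set_entry ne.
Qed.

(** Diagonal matrices when the factors of F span in each slot; otherwise
    matrices that kill F in one slot, and zero in the two others. *)
Lemma rank_ker_act_diff F :
  rank_at_most n F -> (n <= \rank (kermx (lin_mx (act_diff F))))%N.
Proof.
move=> [r [rn [u [v [w def_F]]]]].
pose U (s : 'I_3) : 'M[C R]_(r, n) :=
  match val s with 0 => \matrix_l u l | 1 => \matrix_l v l
                 | _ => \matrix_l w l end.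
have FU t : F t = \sum_l \prod_s U s l (entry s t).
  rewrite def_F sum_ffunE; apply: eq_bigr => l _; rewrite ffunE.
  by rewrite !big_ord_recl big_ord0 /U /= !mxE mulr1 mulrA.
have [fullU|] := boolP [forall s, row_full (U s)]; last first.
  rewrite negb_forall => /existsP[s0 notfull].
  have /rowV0Pn[z zU z0] : kermx (U s0)^T != 0.
    rewrite -mxrank_eq0 mxrank_ker mxrank_tr subn_eq0 -ltnNge.
    by rewrite ltn_neqAle notfull rank_leq_col.
  have Uz : U s0 *m z^T = 0.
    by apply: trmx_inj; rewrite trmx_mul trmxK trmx0; exact/sub_kermxP.
  (* the rows of U s0 are killed by z, so by the rank one matrix [c^T *m z] *)
  pose X (s : 'I_3) (c : 'rV[C R]_n) := if s == s0 then (z^T *m c)^T else 0.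
  refine (@rank_ker_act_diff_param n F X _ _ _).
  - move=> s a c d; rewrite /X; case: eqP => _; last by rewrite scaler0 addr0.
    by rewrite -!linearP.
  - have XF0 c s : act s (X s c) F = 0.
      rewrite /X; case: eqP => [->|_]; last exact: act0.
      apply/ffunP => t; rewrite (act_sum_products _ _ _ FU) trmxK mulmxA Uz.
      by rewrite mul0mx [RHS]ffunE big1 // => l _; rewrite mxE mul0r.
    by move=> c s; rewrite !XF0.
  - move=> c /(_ s0); rewrite /X eqxx => /matrixP zc0.
    have [i zi] : exists i, z 0 i != 0.
      apply/existsP; apply: contraNT z0 => /existsPn z0; apply/eqP/rowP => i.
      by rewrite mxE; apply/eqP; rewrite -[_ == _]negbK z0.
    apply/rowP => j; have := zc0 j i; rewrite !mxE big_ord1 !mxE => /eqP.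
    by rewrite mulf_eq0 (negPf zi) => /eqP.
have rE : r = n.
  apply/eqP; rewrite eqn_leq rn -(eqP (forallP fullU slotA)).
  exact: rank_leq_row.
subst r.
have /fin_all_exists[U' UU'] s : exists U', U s *m U' = 1%:M.
  apply/row_freeP; rewrite /row_free; exact: forallP fullU s.
(* transposed, as matrices act on the rows of U s through their transposes: this
   is the matrix for which the l-th row of U s has eigenvalue c 0 l *)
pose X s (c : 'rV[C R]_n) := (U' s *m diag_mx c *m U s)^T.
refine (@rank_ker_act_diff_param n F X _ _ _).
- by move=> s a c d; rewrite /X linearD linearZ /= mulmxDr mulmxDl
    -scalemxAr -scalemxAl linearP.
- have XF c s t : act s (X s c) F t =
      \sum_l c 0 l * \prod_s' U s' l (entry s' t).
    rewrite (act_sum_products _ _ _ FU) trmxK !mulmxA UU' mul1mx.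
    apply: eq_bigr => l _; rewrite mul_diag_mx mxE -mulrA.
    by rewrite [in RHS](bigD1 s).
  by move=> c s; apply/ffunP => t; rewrite !XF.
move=> c /(_ slotA) /(congr1 trmx); rewrite trmxK trmx0 => Uc0.
have : diag_mx c = 0.
  transitivity (U slotA *m (U' slotA *m diag_mx c *m U slotA) *m U' slotA).
    by rewrite !mulmxA UU' mul1mx -mulmxA UU' mulmx1.
  by rewrite Uc0 mulmx0 mul0mx.
move=> /matrixP c0; apply/rowP => l; have := c0 l l.
by rewrite !mxE eqxx.
Qed.
End Abundance.

(** * Forms of degree (1,1,1) *)

Section Degree111.
Variables (R : realType) (n : nat).
Notation triples := ('I_n * 'I_n * 'I_n)%type.
Notation N := #|{: triples}|.
Implicit Types (F G : tensor R n) (r : 'rV[C R]_N).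

Definition form111 r : S R n := \sum_k r 0 k *: 'X_[tmon (enum_val k)].

Fact form111_is_linear : linear form111.
Proof.
move=> c r r'; rewrite /form111 scaler_sumr -big_split; apply: eq_bigr => k _.
by rewrite !mxE scalerDl scalerA.
Qed.
HB.instance Definition _ :=
  GRing.isLinear.Build _ _ _ _ form111 form111_is_linear.

Definition tensor_row F : 'rV[C R]_N := \row_k F (enum_val k).

Lemma mcoeff_form111 r k : (form111 r)@_(tmon (enum_val k)) = r 0 k.
Proof.
rewrite raddf_sum (bigD1 k) //= big1 => [|k' /negPf ne].
  by rewrite addr0 mcoeffZ mcoeffX eqxx mulr1.
rewrite mcoeffZ mcoeffX (inj_eq (@tmon_inj n)) (inj_eq enum_val_inj) ne.
exact: mulr0.
Qed.

Lemma form111_piece r : piece (1, 1, 1) (form111 r).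
Proof.
move=> m /msupp_sum_le; rewrite filter_predT => /flattenP[_ /mapP[k _ ->]].
move=> /msuppZ_le; rewrite msuppX inE => /eqP ->.
by apply/tmonP; exists (enum_val k).
Qed.

Lemma piece_form111 P :
  piece (1, 1, 1) P -> P = form111 (\row_k P@_(tmon (enum_val k))).
Proof.
move=> P1; apply/mpolyP => m.
have [/tmonP[t ->]|m1] := eqVneq (multideg m) (1, 1, 1).
  by rewrite -[t]enum_rankK mcoeff_form111 mxE.
rewrite (piece_mcoeff P1 m1) raddf_sum big1 // => k _ /=.
rewrite mcoeffZ mcoeffX; case: eqP => [mk|_]; last by rewrite mulr0.
by case/eqP: m1; apply/tmonP; exists (enum_val k).
Qed.

Lemma pairing_form111 G r : pairing G (form111 r) = (tensor_row G *m r^T) 0 0.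
Proof.
rewrite mxE /pairing (reindex_onto enum_val enum_rank) => [|t _] /=; last first.
  by rewrite enum_rankK.
under eq_bigl do rewrite enum_valK eqxx.
by apply: eq_bigr => k _; rewrite mcoeff_form111 !mxE.
Qed.

(** Only the component of degree (1,1,1) matters, and the polynomials Psi that
    are tested against it are constant. *)
Lemma Ann_form111 F r : pairing F (form111 r) = 0 -> Ann F (form111 r).
Proof.
move=> r0 D Psi; rewrite /contract (hcomp_piece _ (@form111_piece r)).
case: eqP => [->|_ _]; last by rewrite mul0r linear0.
rewrite subrr => Psi0.
have -> : Psi = Psi@_0%MM *: 1.
  apply/mpolyP => m; rewrite mcoeffZ mcoeff1.
  have [->|m0] := eqVneq m 0%MM; first by rewrite mulr1.
  rewrite mulr0 (piece_mcoeff Psi0) //.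
  by apply: contra m0 => /eqP/multideg_eq0 ->.
by rewrite -scalerAr mulr1 linearZ /= r0 mulr0.
Qed.

(** The rows of H are tensors G that come from triples spanning the whole space
    of triples; by conciseness a triple is determined by its G, so that H has the
    rank of this space. *)
Lemma concise_abundant F :
  concise F -> border_rank_at_most n F ->
  exists2 H : 'M[C R]_(3 * (n * n), N), (n <= \rank H)%N
    & forall i, exists X : 'I_3 -> 'M[C R]_n, exists2 G,
        forall s, act s (X s) F = G & row i H = tensor_row G.
Proof.
move=> cF [T [rT TF]].
have np m : (\rank (lin_mx (act_diff (T m))) <= 3 * (n * n) - n)%N.
  have := rank_ker_act_diff (rT m); rewrite mxrank_ker.
  have := rank_leq_row (lin_mx (act_diff (T m))); lia.
have kerF : (n <= \rank (kermx (lin_mx (act_diff F))))%N.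
  have rF : (\rank (lin_mx (act_diff F)) <= 3 * (n * n) - n)%N.
    exact: rank_limit_le (cvg_lin_mx_act_diff TF) np.
  rewrite mxrank_ker; move: rF.
  have := rank_ker_act_diff (rT 0); rewrite mxrank_ker; lia.
pose f x := tensor_row (act slotA (slot_mx x slotA) F).
have flin : linear f.
  by move=> c x y; apply/rowP => k; rewrite /f slot_mx_linear !mxE act_linear.
pose fL : {linear _ -> _} := HB.pack f (GRing.isLinear.Build _ _ _ _ f flin).
pose fV : {linear _ -> _} := fL \o vec_mx.
pose K := kermx (lin_mx (act_diff F)).
have slots v : (v <= K)%MS ->
    forall s, act s (slot_mx (vec_mx v) s) F
              = act slotA (slot_mx (vec_mx v) slotA) F.
  move=> /sub_kermxP; rewrite mul_rV_lin => /eqP.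
  by rewrite mxvec_eq0 => /eqP/act_diff_eq0.
exists (K *m lin1_mx fV).
  rewrite (leq_trans kerF) // -(mxrank_mul_ker K (lin1_mx fV)).
  rewrite [X in (_ + X)%N](_ : _ = 0%N) ?addn0 //; apply/eqP.
  rewrite mxrank_eq0; apply/rowV0P => v; rewrite sub_capmx => /andP[vK].
  move=> /sub_kermxP; rewrite mul_rV_lin1 /= => fv0.
  have G0 : act slotA (slot_mx (vec_mx v) slotA) F = 0.
    apply/ffunP => t; rewrite [RHS]ffunE; move/rowP/(_ (enum_rank t)): fv0.
    by rewrite /f !mxE enum_rankK.
  apply: (can_inj vec_mxK); rewrite linear0; apply/row_matrixP => s.
  apply: (can_inj vec_mxK); rewrite !linear0.
  by apply: (concise_act_inj cF (s := s)); rewrite (slots _ vK).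
move=> i; rewrite row_mul mul_rV_lin1 /=.
pose x := vec_mx (row i K).
exists (slot_mx x), (act slotA (slot_mx x slotA) F) => //.
by apply: slots; exact: row_sub.
Qed.

End Degree111.

Theorem theorem1p3 (R : realType) (n : nat) (F : tensor R n) :
  concise F -> has_border_rank F n ->
  exists d : nat,
    num_min_generators (Ann F) (1, 1, 1)%R d /\ (n - 1 <= d)%N.
Proof.
move=> cF [brF _]; have [H rH Hrow] := concise_abundant cF brF.
pose W := ideal_mul (@max_ideal R n) (Ann F) `&` piece (1, 1, 1).
have W0 : W (form111 0).
  split; last exact: form111_piece.
  by rewrite linear0; exact: ideal_mul0.
have WD c r r' : W (form111 r) -> W (form111 r') -> W (form111 (c *: r + r')).
  move=> [Wr _] [Wr' _]; split; last exact: form111_piece.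
  rewrite linearP.
  by apply: ideal_mulD => //; exact: max_ideal_mulZ.
have [B WB] := subspace_row_space (W := [set r | W (form111 r)]) W0 WD.
pose A := kermx (tensor_row F)^T.
have perpP (G : tensor R n) r :
    (r <= kermx (tensor_row G)^T)%MS <-> pairing G (form111 r) = 0.
  rewrite pairing_form111; split=> [/sub_kermxP rG|rG].
    by rewrite -[_ *m _]trmxK trmx_mul trmxK rG trmx0 mxE.
  apply/sub_kermxP/trmx_inj; rewrite trmx_mul trmxK trmx0.
  by apply/rowP => i; rewrite ord1 rG mxE.
(* F itself is one of the tensors G, for the triple of identity matrices *)
have BA : (B <= A)%MS.
  apply/rV_subP => r /WB[Wr _]; apply/perpP.
  by apply: max_ideal_Ann_perp Wr => s; exact: act1.
have BH : (B <= kermx H^T)%MS.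
  apply/rV_subP => r /WB[Wr _]; apply/sub_kermxP/trmx_inj.
  rewrite trmx_mul trmxK trmx0; apply/row_matrixP => i.
  rewrite row_mul row0; have [X [G XG ->]] := Hrow i.
  apply/rowP => j; rewrite ord1 -pairing_form111 mxE.
  exact: max_ideal_Ann_perp Wr.
exists (\rank A - \rank B)%N; split.
  apply: dim_quotient_row_spaces (WB) BA => P; split=> [[PF]|[r rA ->]].
    move=> /piece_form111 def_P; exists (\row_k P@_(tmon (enum_val k))) => //.
    by apply/perpP; rewrite -def_P -[P]mulr1; exact: Ann_pairing.
  have rF : pairing F (form111 r) = 0 by exact/perpP.
  by split; [exact: Ann_form111 | exact: form111_piece].
have := mxrankS BH; rewrite !mxrank_ker mxrank_tr.
have := rank_leq_row (tensor_row F)^T; have := rank_leq_col (tensor_row F)^T.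
have := rank_leq_col H; lia.
Qed.
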